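(* Let $\Gamma$ be a set of formulas of independence logic $\mathsf{FO}(\perp_c)$ (over some first-order signature $\tau$, with arbitrarily many free variables). If every finite subset $\Gamma_0$ of $\Gamma$ is satisfiable, then $\Gamma$ is satisfiable.
   Context: Syntax. Let $\tau$ be a first-order signature. The $\tau$-formulas of independence logic $\mathsf{FO}(\perp_c)$ are given by $$\phi ::= t=t' \mid \neg t=t' \mid R(\vec t) \mid \neg R(\vec t) \mid \vec x\perp_{\vec z}\vec y \mid \phi\land\phi \mid \phi\vee\phi \mid \exists x\,\phi \mid \forall x\,\phi,$$ where $t,t'$ are $\tau$-terms, $\vec t$ is a tuple of $\tau$-terms, $R\in\tau$ is a relation symbol, and $\vec x,\vec y,\vec z$ are finite tuples of variables. Teams. For a $\tau$-structure $\mathcal M$ with domain $M$ and a set $D$ of variables (possibly infinite), an assignment of $\mathcal M$ is a map $s\colon D\to M$, and a team of $\mathcal M$ with domain $\mathrm{dom}(X)=D$ is a set $X$ of assignments $D\to M$. Write $s(t)$ for the value of the term $t$ under $s$, and $s(\vec t)$ for the tuple of values. For $a\in M$, $s(a/x)$ is the assignment mapping $x$ to $a$ and agreeing with $s$ on all other variables. For $F\colon X\to\wp(M)\setminus\{\emptyset\}$ put $X(F/x)=\{s(a/x)\mid s\in X,\ a\in F(s)\}$, and put $X(M/x)=\{s(a/x)\mid s\in X,\ a\in M\}$. Semantics. - $\mathcal M\models_X\lambda$, for $\lambda$ a first-order atomic or negated atomic formula, iff every $s\in X$ satisfies $\lambda$ in $\mathcal M$ in the usual Tarskian sense. - $\mathcal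 M\models_X\vec x\perp_{\vec z}\vec y$ iff for all $s,s'\in X$ with $s(\vec z)=s'(\vec z)$ there is $s''\in X$ with $s''(\vec x\vec z)=s(\vec x\vec z)$ and $s''(\vec y)=s'(\vec y)$. - $\mathcal M\models_X\psi\land\chi$ iff $\mathcal M\models_X\psi$ and $\mathcal M\models_X\chi$. - $\mathcal M\models_X\psi\vee\chi$ iff there are $Y,Z\subseteq X$ with $Y\cup Z=X$, $\mathcal M\models_Y\psi$ and $\mathcal M\models_Z\chi$. - $\mathcal M\models_X\exists x\,\psi$ iff there is $F\colon X\to\wp(M)\setminus\{\emptyset\}$ with $\mathcal M\models_{X(F/x)}\psi$. - $\mathcal M\models_X\forall x\,\psi$ iff $\mathcal M\models_{X(M/x)}\psi$. Satisfiability. $\mathcal M\models_X\Gamma$ means $\mathcal M\models_X\phi$ for all $\phi\in\Gamma$ (where $\mathrm{dom}(X)$ contains all free variables of $\Gamma$). A set $\Gamma$ of formulas is satisfiable if there are a structure $\mathcal M$ and a nonempty team $X$ of $\mathcal M$ with $\mathcal M\models_X\Gamma$. *)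

(* Defs.v *)
From mathcomp Require Import all_boot.
From mathcomp Require Import boolp classical_sets functions cardinality.

Set Implicit Arguments.
Unset Strict Implicit.
Unset Printing Implicit Defensive.

Local Open Scope classical_set_scope.

(* Constant symbols are the function symbols of arity 0. *)
Record signature : Type := Signature {
  fsymb : Type;
  rsymb : Type;
  farity : fsymb -> nat;
  rarity : rsymb -> nat
}.

Record structure (tau : signature) : Type := Structure {
  carrier :> Type;
  carrier_inhabited : inhabited carrier;
  fun_interp : forall f : fsymb tau, ('I_(farity f) -> carrier) -> carrier;
  rel_interp : forall r : rsymb tau, ('I_(rarity r) -> carrier) -> Prop
}.

(* The type V of variables is arbitrary, in particular of any cardinality. *)
Inductive term (tau : signature) (V : eqType) : Type :=
| Var (x : V)
| App (f : fsymb tau) (args : 'I_(farity f) -> term tau V).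

(* [Indep x z y] is the conditional independence atom usually written with the
   tuple z as a subscript: x is independent of y given z. *)
Inductive formula (tau : signature) (V : eqType) : Type :=
| Eq (t t' : term tau V)
| Neq (t t' : term tau V)
| Rel (r : rsymb tau) (args : 'I_(rarity r) -> term tau V)
| Nrel (r : rsymb tau) (args : 'I_(rarity r) -> term tau V)
| Indep (x z y : seq V)
| And (phi psi : formula tau V)
| Or (phi psi : formula tau V)
| Ex (x : V) (phi : formula tau V)
| All (x : V) (phi : formula tau V).

Fixpoint term_vars (tau : signature) (V : eqType) (t : term tau V) : set V :=
  match t with
  | Var x => [set x]
  | App _ args => \bigcup_(i in setT) term_vars (args i)
  end.

Fixpoint free_vars (tau : signature) (V : eqType) (phi : formula tau V)
    : set V :=
  match phi with
  | Eq t t' | Neq t t' => term_vars t `|` term_vars t'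
  | Rel _ args | Nrel _ args => \bigcup_(i in setT) term_vars (args i)
  | Indep x z y => [set v | v \in x ++ z ++ y]
  | And psi chi | Or psi chi => free_vars psi `|` free_vars chi
  | Ex x psi | All x psi => free_vars psi `\` [set x]
  end.

(* An assignment D -> M is encoded as a partial function on V which is defined
   exactly on D; see [team_with_dom]. *)
Definition assignment (V : eqType) (M : Type) : Type := V -> option M.

Definition assign_dom (V : eqType) (M : Type) (s : assignment V M) : set V :=
  [set x | s x <> None].

Definition team_with_dom (V : eqType) (M : Type) (D : set V)
    (X : set (assignment V M)) : Prop :=
  forall s, X s -> assign_dom s = D.

(* If x is not in the domain of s, then it is added to the domain. *)
Definition update (V : eqType) (M : Type) (s : assignment V M) (a : M) (x : V)
    : assignment V M :=
  fun y => if y == x then Some a else s y.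

(* X(F/x); only the values of F on X matter. *)
Definition supplement (V : eqType) (M : Type) (X : set (assignment V M))
    (F : assignment V M -> set M) (x : V) : set (assignment V M) :=
  [set s' | exists s a, [/\ X s, F s a & s' = update s a x]].

(* X(M/x) *)
Definition duplicate (V : eqType) (M : Type) (X : set (assignment V M)) (x : V)
    : set (assignment V M) :=
  [set s' | exists s a, X s /\ s' = update s a x].

(* [term_value s t a]: the value s(t) is defined and equal to a.  It is defined
   as soon as the variables of t are in the domain of s. *)
Fixpoint term_value (tau : signature) (V : eqType) (M : structure tau)
    (s : assignment V M) (t : term tau V) (a : M) : Prop :=
  match t with
  | Var x => s x = Some a
  | App f args =>
      exists b : 'I_(farity f) -> M,
        (forall i, term_value s (args i) (b i)) /\ a = fun_interp b
  end.

Fixpoint models (tau : signature) (V : eqType) (M : structure tau)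
    (X : set (assignment V M)) (phi : formula tau V) : Prop :=
  match phi with
  | Eq t t' => forall s, X s ->
      exists a b : M, [/\ term_value s t a, term_value s t' b & a = b]
  | Neq t t' => forall s, X s ->
      exists a b : M, [/\ term_value s t a, term_value s t' b & a <> b]
  | Rel r args => forall s, X s ->
      exists a : 'I_(rarity r) -> M,
        (forall i, term_value s (args i) (a i)) /\ rel_interp a
  | Nrel r args => forall s, X s ->
      exists a : 'I_(rarity r) -> M,
        (forall i, term_value s (args i) (a i)) /\ ~ rel_interp a
  | Indep x z y => forall s s', X s -> X s' -> map s z = map s' z ->
      exists s'', [/\ X s'', map s'' (x ++ z) = map s (x ++ z)
                    & map s'' y = map s' y]
  | And psi chi => models X psi /\ models X chi
  | Or psi chi => exists Y Z : set (assignment V M),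
      [/\ Y `<=` X, Z `<=` X, Y `|` Z = X, models Y psi & models Z chi]
  | Ex x psi => exists F : assignment V M -> set M,
      (forall s, X s -> F s !=set0) /\ models (supplement X F x) psi
  | All x psi => models (duplicate X x) psi
  end.

Definition satisfiable (tau : signature) (V : eqType)
    (Gamma : set (formula tau V)) : Prop :=
  exists (M : structure tau) (D : set V) (X : set (assignment V M)),
    [/\ team_with_dom D X, X !=set0,
        forall phi, Gamma phi -> free_vars phi `<=` D
      & forall phi, Gamma phi -> models X phi].

(* Main.v *)
Require Import Defs.
From mathcomp Require Import all_boot generic_quotient.
From mathcomp Require Import boolp classical_sets functions cardinality filter.

Set Implicit Arguments.
Unset Strict Implicit.
Unset Printing Implicit Defensive.

Local Open Scope classical_set_scope.

(** The proof is by ultraproducts.  A team is a set of functions, and the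
    ultraproduct of teams [X i] of structures [M i] can be taken to be the set
    of all limits of families [r] with [r i] in [X i] for almost all [i]: the
    limit of [r] sends a variable [x] to the class of the values [r i x].  This
    full team makes one direction of the theorem of Los true for every formula
    ([los]): what holds of almost all [X i] holds of their ultraproduct.  The
    clauses of the semantics that quantify over assignments or teams carry over
    for the following reasons.
    - Witnesses [s''] of independence atoms are chosen index by index; as tuples
      are finite, agreement of limits on a tuple is agreement at almost all
      indices.
    - If every [X i] is the union of [Y i] and [Z i], then the ultraproduct of
      the [X i] is the union of those of the [Y i] and the [Z i], because an
      ultrafilter that contains a union of two sets contains one of them.
    - Ultraproducts commute with supplementation and duplication, because
      limits commute with [update] and every element of the ultraproduct is a
      class.
    For compactness, take for every finite subset of [Gamma] a structure and a
    team that satisfy it, and an ultrafilter on these finite subsets that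
    contains, for each formula of [Gamma], the set of those to which the formula
    belongs.  A free variable of such a formula is in the domain of almost all
    of the teams, hence in that of their ultraproduct; since limits of
    assignments are computed one variable at a time, the set of all free
    variables may be infinite. *)

(** * Ultraproducts of structures *)

Section Ultraproduct.

Context {I : Type} (U : set_system I) {UU : UltraFilter U}.

Lemma near_choice (T : I -> Type) (P : forall i, T i -> Prop) :
  (forall i, inhabited (T i)) ->
  (\forall i \near U, exists a, P i a) ->
  exists f : forall i, T i, \forall i \near U, P i (f i).
Proof.
move=> inhT UP.
have h i : {a : T i | (exists b, P i b) -> P i a}.
  apply: cid; have [[a Pa]|nP] := pselect (exists b, P i b); first by exists a.
  by have [a] := inhT i; exists a.
exists (fun i => sval (h i)).
by apply: filterS UP => i; apply: (svalP (h i)).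
Qed.

Lemma near_absurd : ~ (\forall i \near U, False).
Proof. exact: filter_not_empty. Qed.

Lemma near_not (P : I -> Prop) :
  ~ (\forall i \near U, P i) -> \forall i \near U, ~ P i.
Proof. by move=> nUP; have [] := in_ultra_setVsetC [set i | P i] UU. Qed.

(** Dependent products are made classical choice types because quotients by a
    boolean relation are taken over types with a choice operator. *)
Definition near_eq {T : I -> Type} (f g : {classic forall i, T i}) : bool :=
  `[< \forall i \near U, f i = g i >].

Lemma near_eq_refl {T : I -> Type} : reflexive (@near_eq T).
Proof. by move=> f; apply/asboolP/filterE. Qed.

Lemma near_eq_sym {T : I -> Type} : symmetric (@near_eq T).
Proof.
by move=> f g; apply/asboolP/asboolP; apply: filterS => i ->.
Qed.

Lemma near_eq_trans {T : I -> Type} : transitive (@near_eq T).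
Proof.
move=> g f h /asboolP fg /asboolP gh; apply/asboolP.
by apply: filterS2 fg gh => i ->.
Qed.

Canonical near_eq_equiv (T : I -> Type) : equiv_rel _ :=
  EquivRel (@near_eq T) near_eq_refl near_eq_sym near_eq_trans.

Definition uprod (T : I -> Type) : Type := {eq_quot @near_eq T}%qT.

Definition uclass {T : I -> Type} (f : forall i, T i) : uprod T :=
  \pi_({eq_quot @near_eq T})%qT f.

Lemma uclass_eq {T : I -> Type} (f g : forall i, T i) :
  uclass f = uclass g <-> \forall i \near U, f i = g i.
Proof.
by split=> [/eqmodP/asboolP|fg] //; apply/eqmodP/asboolP.
Qed.

Definition urepr {T : I -> Type} (c : uprod T) : forall i, T i :=
  repr (c : {eq_quot @near_eq T}%qT).

Lemma ureprK {T : I -> Type} (c : uprod T) : uclass (urepr c) = c.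
Proof. exact: reprK. Qed.

Lemma near_urepr {T : I -> Type} (f : forall i, T i) :
  \forall i \near U, urepr (uclass f) i = f i.
Proof. by apply/uclass_eq; rewrite ureprK. Qed.

Context {tau : signature} {V : eqType} (M : I -> structure tau).

Let assignment_inhabited i : inhabited (assignment V (M i)) :=
  inhabits (fun=> None).

Let carriers_inhabited i : inhabited (M i) := carrier_inhabited (M i).

Let carrier_tuple_inhabited (n : nat) i : inhabited ('I_n -> M i) :=
  let: inhabits a := carrier_inhabited (M i) in inhabits (fun=> a).

Lemma uprod_inhabited : inhabited (uprod (fun i => M i)).
Proof.
have [|f _] := @near_choice _ (fun _ _ => True) carriers_inhabited.
  by apply: filterE => i; have [a] := carriers_inhabited i; exists a.
exact: inhabits (uclass f).
Qed.

(** Symbols are interpreted on chosen representatives; that the choice is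
    immaterial is the content of [fun_interp_ultraproduct] and
    [rel_interp_ultraproduct]. *)
Definition ultraproduct : structure tau :=
  @Structure tau (uprod (fun i => M i)) uprod_inhabited
    (fun f b => uclass (fun i => fun_interp (fun k => urepr (b k) i)))
    (fun r b => \forall i \near U, rel_interp (fun k => urepr (b k) i)).

(** The representatives of the entries agree with [b] on one set of the
    ultrafilter per entry, and arities are finite, so that these sets have a
    common intersection in the ultrafilter. *)
Lemma near_urepr_tuple n (b : forall i, 'I_n -> M i) :
  \forall i \near U,
    (fun k => urepr (uclass (fun j => b j k)) i) = b i.
Proof.
have /filter_forall : forall k : 'I_n,
  \forall i \near U, urepr (uclass (fun j => b j k)) i = b i k.
  by move=> k; apply: (near_urepr (fun j => b j k)).
by apply: filterS => i bi; apply/funext.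
Qed.

Lemma fun_interp_ultraproduct (f : fsymb tau)
    (b : forall i, 'I_(farity f) -> M i) :
  fun_interp (s := ultraproduct) (fun k => uclass (fun i => b i k)) =
  uclass (fun i => fun_interp (b i)).
Proof.
by apply/uclass_eq; apply: filterS (near_urepr_tuple b) => i ->.
Qed.

Lemma rel_interp_ultraproduct (r : rsymb tau)
    (b : forall i, 'I_(rarity r) -> M i) :
  rel_interp (s := ultraproduct) (fun k => uclass (fun i => b i k)) <->
  \forall i \near U, rel_interp (b i).
Proof.
by split; apply: filterS2 (near_urepr_tuple b) => i ->.
Qed.

(** * Limits of assignments *)

(** The class of a family of partial values; it is undefined when almost all
    of the values are. *)
Definition olim (o : forall i, option (M i)) : option ultraproduct :=
  if pselect (exists f : forall i, M i, \forall i \near U, o i = Some (f i))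
    is left fP then Some (uclass (sval (cid fP))) else None.

Variant olim_spec (o : forall i, option (M i)) : option ultraproduct -> Prop :=
| OlimSome (f : forall i, M i) of (\forall i \near U, o i = Some (f i)) :
    olim_spec o (Some (uclass f))
| OlimNone of (\forall i \near U, o i = None) : olim_spec o None.

(** The indices at which a partial value is defined form a set that is in the
    ultrafilter or has its complement there. *)
Lemma olimP o : olim_spec o (olim o).
Proof.
rewrite /olim; case: pselect => [fP|nP].
  by constructor; apply: (svalP (cid fP)).
constructor; apply: contrapT => /near_not sP; apply: nP.
apply: (near_choice carriers_inhabited (P := fun i a => o i = Some a)).
by apply: filterS sP => i; case: (o i) => // a _; exists a.
Qed.

Lemma olim_eq o o' : olim o = olim o' <-> \forall i \near U, o i = o' i.
Proof.
case: (olimP o) (olimP o') => [f of_|on] [g og|on']; split=> //.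
- move=> [] /uclass_eq fg.
  by apply: filterS3 of_ og fg => i -> -> ->.
- move=> oo'; congr Some; apply/uclass_eq.
  by apply: filterS3 of_ og oo' => i -> -> [].
- by move=> oo'; case: near_absurd; apply: filterS3 of_ on' oo' => i -> ->.
- by move=> oo'; case: near_absurd; apply: filterS3 on og oo' => i -> ->.
- by move=> _; apply: filterS2 on on' => i -> ->.
Qed.

Lemma olim_Some (f : forall i, M i) : olim (fun i => Some (f i)) = Some (uclass f).
Proof.
case: olimP => [g|] fg.
  by congr Some; apply/uclass_eq; apply: filterS fg => i [].
by case: near_absurd; apply: filterS fg.
Qed.

Definition alim (r : forall i, assignment V (M i)) : assignment V ultraproduct :=
  fun x => olim (fun i => r i x).

Lemma alim_eq r r' : (\forall i \near U, r i = r' i) -> alim r = alim r'.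
Proof.
by move=> rr'; apply/funext => x; apply/olim_eq; apply: filterS rr' => i ->.
Qed.

Lemma alim_update r (f : forall i, M i) x :
  alim (fun i => update (r i) (f i) x) = update (alim r) (uclass f) x.
Proof.
apply/funext => y; rewrite /alim /update; case: (y == x) => //.
exact: olim_Some.
Qed.

(** As tuples of variables are finite, entrywise agreement at almost all indices
    is simultaneous agreement at almost all indices. *)
Lemma alim_map_eq r r' (z : seq V) :
  map (alim r) z = map (alim r') z <->
  \forall i \near U, map (r i) z = map (r' i) z.
Proof.
elim: z => [|x z IH] /=; first by split=> // _; apply: filterE.
split=> [[/olim_eq rx /IH rz]|rr'].
  by apply: filterS2 rx rz => i -> ->.
congr cons; first by apply/olim_eq; apply: filterS rr' => i [].
by apply/IH; apply: filterS rr' => i [].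
Qed.

(** This direction suffices for all literals: a literal that holds of an
    assignment comes with values for its terms. *)
Lemma term_value_alim r (t : term tau V) (f : forall i, M i) :
  (\forall i \near U, term_value (r i) t (f i)) ->
  term_value (alim r) t (uclass f : ultraproduct).
Proof.
elim: t f => [x|g args IH] f /= rf.
  by rewrite /alim -olim_Some; apply/olim_eq.
have [b bP] := near_choice (carrier_tuple_inhabited _) rf.
exists (fun k => uclass (fun i => b i k)); split.
  by move=> k; apply: IH; apply: filterS bP => i [].
apply: etrans _ (esym (fun_interp_ultraproduct b)); apply/uclass_eq.
by apply: filterS bP => i [].
Qed.

(** * The ultraproduct of teams *)

(** The condition is imposed on almost all indices because [X i] may be empty
    at the others. *)
Definition uteam (X : forall i, set (assignment V (M i))) :
    set (assignment V ultraproduct) :=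
  [set s | exists2 r, (\forall i \near U, X i (r i)) & s = alim r].

Lemma uteamS (X Y : forall i, set (assignment V (M i))) :
  (\forall i \near U, X i `<=` Y i) -> uteam X `<=` uteam Y.
Proof.
move=> XY s [r Xr ->]; exists r => //.
by apply: filterS2 XY Xr => i; apply.
Qed.

(** If the indices with [r i] in [X i] are not in the ultrafilter, then their
    complement is, and there [r i] is in [Y i]. *)
Lemma uteamU (X Y : forall i, set (assignment V (M i))) :
  uteam (fun i => X i `|` Y i) = uteam X `|` uteam Y.
Proof.
apply/seteqP; split=> [s [r Xr ->]|s]; last first.
  by case; apply: uteamS; apply: filterE => i r; [left|right].
have [UX|/near_not nUX] := pselect (\forall i \near U, X i (r i)).
  by left; exists r.
by right; exists r => //; apply: filterS2 Xr nUX => i [].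
Qed.

Lemma eq_uteam (X Y : forall i, set (assignment V (M i))) :
  (\forall i \near U, X i = Y i) -> uteam X = uteam Y.
Proof.
by move=> XY; apply/seteqP; split; apply: uteamS; apply: filterS XY => i ->.
Qed.

(** The supplementing function is the largest one that keeps the values in the
    ultraproduct of the supplemented teams, so one inclusion is immediate.  For
    the other, a limit of updates is the update of a limit. *)
Lemma uteam_supplement X (F : forall i, assignment V (M i) -> set (M i)) x :
  uteam (fun i => supplement (X i) (F i) x) =
  supplement (uteam X)
    (fun s => [set a | uteam (fun i => supplement (X i) (F i) x) (update s a x)])
    x.
Proof.
apply/seteqP; split=> [_ [r' r'P ->]|_ [s [a [_ ? ->]]]] //.
have [r rP] := near_choice assignment_inhabited r'P.
have [f fP] := near_choice carriers_inhabited rP.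
have r'E : alim r' = update (alim r) (uclass f) x.
  by rewrite -alim_update; apply: alim_eq; apply: filterS fP => i [].
exists (alim r), (uclass f); split=> //.
- by exists r => //; apply: filterS fP => i [].
- by rewrite /= -r'E; exists r'.
Qed.

(** Every element of the ultraproduct is the class of a family, so that an
    update of a limit is a limit of updates. *)
Lemma uteam_duplicate X x :
  uteam (fun i => duplicate (X i) x) = duplicate (uteam X) x.
Proof.
apply/seteqP; split=> [_ [r' r'P ->]|_ [_ [a [[r rP ->] ->]]]].
  have [r rP] := near_choice assignment_inhabited r'P.
  have [f fP] := near_choice carriers_inhabited rP.
  exists (alim r), (uclass f); split.
    by exists r => //; apply: filterS fP => i [].
  by rewrite -alim_update; apply: alim_eq; apply: filterS fP => i [].
rewrite -[a]ureprK -alim_update; eexists; last by [].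
by apply: filterS rP => i Xr; exists (r i), (urepr a i).
Qed.

Lemma near_in_team X r (P : forall i, assignment V (M i) -> Prop) :
  (\forall i \near U, forall s, X i s -> P i s) ->
  (\forall i \near U, X i (r i)) -> \forall i \near U, P i (r i).
Proof. by apply: filterS2 => i; apply. Qed.

(** Only truth is transferred, from almost all indices to the limit: witnesses
    (values of terms, assignments, parts of a split, supplementing functions)
    are chosen index by index with [near_choice] and then pass to the limit. *)
Lemma los (phi : formula tau V) (X : forall i, set (assignment V (M i))) :
  (\forall i \near U, models (X i) phi) -> models (uteam X) phi.
Proof.
elim: phi X => [t t'|t t'|R args|R args|x z y|phi IHphi psi IHpsi
  |phi IHphi psi IHpsi|x phi IH|x phi IH] X /= Xphi.
- move=> _ [r rX ->].
  have /(near_choice carriers_inhabited)[f] := near_in_team Xphi rX.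
  move=> /(near_choice carriers_inhabited)[g fg].
  exists (uclass f), (uclass g); split.
  + by apply: term_value_alim; apply: filterS fg => i [].
  + by apply: term_value_alim; apply: filterS fg => i [].
  + by apply/uclass_eq; apply: filterS fg => i [].
- move=> _ [r rX ->].
  have /(near_choice carriers_inhabited)[f] := near_in_team Xphi rX.
  move=> /(near_choice carriers_inhabited)[g fg].
  exists (uclass f), (uclass g); split.
  + by apply: term_value_alim; apply: filterS fg => i [].
  + by apply: term_value_alim; apply: filterS fg => i [].
  + by move=> /uclass_eq fg'; case: near_absurd; apply: filterS2 fg fg' => i [].
- move=> _ [r rX ->].
  have /(near_choice (carrier_tuple_inhabited _))[b bP] := near_in_team Xphi rX.
  exists (fun k => uclass (fun i => b i k)); split.
    by move=> k; apply: term_value_alim; apply: filterS bP => i [].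
  by apply/rel_interp_ultraproduct; apply: filterS bP => i [].
- move=> _ [r rX ->].
  have /(near_choice (carrier_tuple_inhabited _))[b bP] := near_in_team Xphi rX.
  exists (fun k => uclass (fun i => b i k)); split.
    by move=> k; apply: term_value_alim; apply: filterS bP => i [].
  move=> /rel_interp_ultraproduct b'; case: near_absurd.
  by apply: filterS2 bP b' => i [].
- move=> _ _ [r rX ->] [r' r'X ->] /alim_map_eq rr'.
  have /(near_choice assignment_inhabited)[r'' r''P] : \forall i \near U,
      exists s'', [/\ X i s'', map s'' (x ++ z) = map (r i) (x ++ z)
                    & map s'' y = map (r' i) y].
    by apply: filterS3 Xphi (filterI rX r'X) rr' => i h []; apply: h.
  exists (alim r''); split.
  + by exists r'' => //; apply: filterS r''P => i [].
  + by apply/alim_map_eq; apply: filterS r''P => i [].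
  + by apply/alim_map_eq; apply: filterS r''P => i [].
- by split; [apply: IHphi|apply: IHpsi]; apply: filterS Xphi => i [].
- have inh i : inhabited (set (assignment V (M i))) := inhabits set0.
  have [Y /(near_choice inh)[Z YZ]] := near_choice inh Xphi.
  have XE : uteam Y `|` uteam Z = uteam X.
    by rewrite -uteamU; apply: eq_uteam; apply: filterS YZ => i [].
  exists (uteam Y), (uteam Z); split=> //.
  + by rewrite -XE; apply: subsetUl.
  + by rewrite -XE; apply: subsetUr.
  + by apply: IHphi; apply: filterS YZ => i [].
  + by apply: IHpsi; apply: filterS YZ => i [].
- have inh i : inhabited (assignment V (M i) -> set (M i)) := inhabits (fun=> set0).
  have [F FP] := near_choice inh Xphi.
  exists (fun s => [set a |
    uteam (fun i => supplement (X i) (F i) x) (update s a x)]); split.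
    move=> _ [r rX ->].
    have /(near_choice carriers_inhabited)[f fP] : \forall i \near U, F i (r i) !=set0.
      by apply: filterS2 FP rX => i [FN0 _]; apply: FN0.
    exists (uclass f); rewrite /= -alim_update; eexists; last by [].
    by apply: filterS2 rX fP => i ? ?; exists (r i), (f i).
  by rewrite -uteam_supplement; apply: IH; apply: filterS FP => i [].
- by rewrite -uteam_duplicate; apply: IH.
Qed.

(** A variable at which almost all [r i] are defined is a variable at which
    [alim r] is defined, and conversely. *)
Lemma uteam_dom (D : I -> set V) X :
  (\forall i \near U, team_with_dom (D i) (X i)) ->
  team_with_dom [set x | \forall i \near U, D i x] (uteam X).
Proof.
move=> XD _ [r rX ->]; apply/seteqP; split=> x; rewrite /assign_dom /alim /=.
  case: olimP => // f rf _.
  by apply: filterS3 XD rX rf => i h /h <- rix; rewrite /assign_dom /= rix.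
case: olimP => // rN xD; case: near_absurd.
by apply: filterS3 (filterI XD rX) xD rN => i [h /h <-].
Qed.

Lemma uteam_neq0 X : (\forall i \near U, X i !=set0) -> uteam X !=set0.
Proof.
by move=> /(near_choice assignment_inhabited)[r rX]; exists (alim r), r.
Qed.

End Ultraproduct.

(** * Compactness *)

(** The sets of all finite subsets of [A] above a given one form a filter base,
    because unions of two finite sets are finite; extend it to an ultrafilter.
    Each [x] in [A] gives the base set above the singleton of [x]. *)
Lemma finite_subsets_ultrafilter {T : Type} (A : set T) :
  exists2 U : set_system {B : set T | B `<=` A /\ finite_set B},
    UltraFilter U & forall x, A x -> \forall B \near U, sval B x.
Proof.
pose I := {B : set T | B `<=` A /\ finite_set B}.
pose above (B : I) := [set C : I | sval B `<=` sval C].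
have above_filter : Filter (filter_from setT above).
  apply: filter_fromT_filter.
    by exists (exist _ set0 (conj (@sub0set _ A) (finite_set0 T)) : I).
  move=> [B [BA finB]] [C [CA finC]].
  have BC : B `|` C `<=` A /\ finite_set (B `|` C).
    by split; [rewrite subUset|rewrite finite_setU].
  by exists (exist _ (B `|` C) BC : I) => E; rewrite /above /= subUset.
have [|U [UU aboveU]] := @ultraFilterLemma _ (filter_from setT above).
  by apply: filter_from_proper => B _; exists B => x.
exists U => // x Ax; apply: aboveU.
have xA : [set x] `<=` A by move=> _ ->.
by exists (exist _ [set x] (conj xA (finite_set1 x)) : I) => // C; apply.
Qed.

Theorem mainTheorem1 (tau : signature) (V : eqType)
    (Gamma : set (formula tau V))
    (finitely_satisfiable : forall Gamma0 : set (formula tau V),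
        Gamma0 `<=` Gamma -> finite_set Gamma0 -> satisfiable Gamma0) :
  satisfiable Gamma.
Proof.
have [U UU UGamma] := finite_subsets_ultrafilter Gamma.
have sat (i : {B : set _ | B `<=` Gamma /\ finite_set B}) :
    satisfiable (sval i).
  by case: i => B [BGamma finB]; apply: finitely_satisfiable.
have {sat} [M sat] := all_tag (fun i => cid (sat i)).
have {sat} [D sat] := choice sat.
have {sat} [X sat] := all_tag (fun i => cid (sat i)).
have [XD X0 XGamma_dom XGamma] := all_and4 sat.
(* A variable is in the new domain when it is in almost all of the domains. *)
exists (ultraproduct (U := U) M), [set x | \forall i \near U, D i x], (uteam X).
split.
- exact: uteam_dom (filterE _ XD).
- exact: uteam_neq0 (filterE _ X0).
- move=> phi /UGamma Uphi x xphi.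
  by apply: filterS Uphi => i iphi; apply: XGamma_dom xphi.
- move=> phi /UGamma Uphi; apply: los.
  by apply: filterS Uphi => i; apply: XGamma.
Qed.
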